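(* Let $g_0=dr^2+h_0^2(r,\theta)\,d\theta^2$ and $g=dr^2+h^2(r,\theta)\,d\theta^2$ be two Riemannian metrics on the surface $M=(a,b)\times N$, where $N$ is either a closed interval of $\mathbb R$ or the circle $\mathbb S^1$, and let $K$, $K_0$ be the Gauss curvatures of $g$ and $g_0$. Let $$m(r,\theta)=-h_0^2\,\partial_r\Big(\ln\big(\tfrac{h}{h_0}\big)\Big),\qquad \mathcal M(r)=\int_N m(r,\theta)\,d\theta .$$ If $(K-K_0)\in L^1(M,h_0^2\,dr\,d\theta)$ and $\mathcal M$ has limits $\mathcal M(a)$ at $a$ and $\mathcal M(b)$ at $b$ (in $\mathbb R$), then $\big(\frac{m}{h_0}\big)^2\in L^1(M,dr\,d\theta)$ and $$\mathcal M(b)-\mathcal M(a)\ \geq\ \int_{(a,b)\times N}(K-K_0)\,h_0^2\,dr\,d\theta,$$ with equality if and only if $K\equiv K_0$ and $m\equiv 0$ (so that $\frac{h}{h_0}$ does not depend on $r$). In particular, if $g$ is asymptotic to $g_0$ at some $r_0\in[a,b]$, then equality holds if and only if $g=g_0$.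
   Context: $(a,b)$ is a non-empty open interval of $\mathbb R$ (possibly unbounded), $h$ and $h_0$ are positive functions on $M$ (both may depend on $(r,\theta)$), and everything is $C^\infty$. The Gauss curvatures are $K=-\frac{\partial_r^2h}{h}$ and $K_0=-\frac{\partial_r^2h_0}{h_0}$. $g$ is said to be asymptotic to $g_0$ at $r_0\in[a,b]$ if, as $r\to r_0$, $h=h_0(1+o(1))$ with the $o(1)$ uniform in $\theta\in N$. *)

(* Defs.v *)
From mathcomp Require Import all_boot all_order all_algebra.
From mathcomp Require Import all_classical all_reals all_analysis.

Set Implicit Arguments.
Unset Strict Implicit.
Unset Printing Implicit Defensive.

Import Order.TTheory GRing.Theory Num.Theory.
Import numFieldNormedType.Exports.

Local Open Scope classical_set_scope.
Local Open Scope ring_scope.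

Inductive fiber (R : realType) : Type :=
| Segment (c d : R) of c < d
| Circle.
Arguments Circle {R}.

(* Range of the coordinate theta.  The circle is R / (2 pi Z): theta ranges over
   the whole line, and functions on the circle are 2 pi-periodic in theta (see
   [well_defined]). *)
Definition coordinates (R : realType) (N : fiber R) : set R :=
  match N with
  | Segment c d _ => `[c, d]
  | Circle => setT
  end.

(* Each point of N has exactly one representative here, so that integration
   over N is integration over this set. *)
Definition fundamental_domain (R : realType) (N : fiber R) : set R :=
  match N with
  | Segment c d _ => `[c, d]
  | Circle => `[0, 2 * pi[
  end.

Definition open_interval (R : realType) (a b : \bar R) : set R :=
  [set r | (a < r%:E)%E && (r%:E < b)%E].

(* M = (a, b) x N, points being given by their coordinates (r, theta). *)
Definition surface (R : realType) (a b : \bar R) (N : fiber R) : set (R * R) :=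
  open_interval a b `*` coordinates N.

Definition surface_domain (R : realType) (a b : \bar R) (N : fiber R) :
    set (R * R) :=
  open_interval a b `*` fundamental_domain N.

Definition well_defined (R : realType) (a b : \bar R) (N : fiber R)
    (f : R * R -> R) : Prop :=
  match N with
  | Segment _ _ _ => True
  | Circle => forall p, surface a b N p -> f (p.1, p.2 + 2 * pi) = f p
  end.

Definition d_r (R : realType) (f : R * R -> R) (p : R * R) : R :=
  derive1 (fun r => f (r, p.2)) p.1.

Definition d_theta (R : realType) (f : R * R -> R) (p : R * R) : R :=
  derive1 (fun theta => f (p.1, theta)) p.2.

Fixpoint C_order (R : realType) (n : nat) (U : set (R * R)) (f : R * R -> R) :
    Prop :=
  (forall p, U p -> {for p, continuous f}) /\
  match n with
  | 0%N => True
  | k.+1 =>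
      [/\ forall p, U p -> derivable (fun r => f (r, p.2)) p.1 1,
          forall p, U p -> derivable (fun theta => f (p.1, theta)) p.2 1,
          C_order k U (d_r f) & C_order k U (d_theta f)]
  end.

(* A segment gives M a boundary, where smoothness means that f extends locally
   to a smooth function on an open subset of the plane. *)
Definition smooth (R : realType) (a b : \bar R) (N : fiber R)
    (f : R * R -> R) : Prop :=
  well_defined a b N f /\
  forall p, surface a b N p ->
    exists (U : set (R * R)) (F : R * R -> R),
      [/\ open U, U p, forall n, C_order n U F &
          forall q, U q -> surface a b N q -> F q = f q].

Definition positive (R : realType) (a b : \bar R) (N : fiber R)
    (f : R * R -> R) : Prop :=
  forall p, surface a b N p -> 0 < f p.

(* The metric dr^2 + h^2 dtheta^2 at the point p, evaluated on two tangent
   vectors given by their components along d/dr and d/dtheta. *)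
Definition metric (R : realType) (h : R * R -> R) (p u v : R * R) : R :=
  u.1 * v.1 + h p ^+ 2 * (u.2 * v.2).

Definition metric_eq (R : realType) (a b : \bar R) (N : fiber R)
    (g g' : R * R -> R * R -> R * R -> R) : Prop :=
  forall p, surface a b N p -> forall u v, g p u v = g' p u v.

Definition curvature (R : realType) (h : R * R -> R) (p : R * R) : R :=
  - (d_r (d_r h) p / h p).

Definition m_fun (R : realType) (h h0 : R * R -> R) (p : R * R) : R :=
  - h0 p ^+ 2 * d_r (fun q => ln (h q / h0 q)) p.

Definition M_fun (R : realType) (N : fiber R) (h h0 : R * R -> R) (r : R) : R :=
  Rintegral lebesgue_measure (fundamental_domain N)
    (fun theta => m_fun h h0 (r, theta)).

Definition area (R : realType) := (@lebesgue_measure R \x @lebesgue_measure R)%E.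
Arguments area : clear implicits.

(* f belongs to L^1(M, w dr dtheta), for a density w >= 0. *)
Definition L1 (R : realType) (a b : \bar R) (N : fiber R)
    (f w : R * R -> R) : Prop :=
  (area R).-integrable (surface_domain a b N) (fun p => (f p * w p)%:E).

(* The filter "r tends to r0, with r in (a, b)", for r0 in [a, b] possibly
   infinite: traces on (a, b) of the neighborhoods of r0 in the extended line. *)
Definition approach (R : realType) (a b r0 : \bar R) : set_system R :=
  within (open_interval a b)
    (filter_from (nbhs r0) (fun A : set (\bar R) => EFin @^-1` A)).

Definition asymptotic (R : realType) (a b : \bar R) (N : fiber R)
    (h h0 : R * R -> R) (r0 : \bar R) : Prop :=
  exists e : R * R -> R,
    (forall p, surface a b N p -> h p = h0 p * (1 + e p)) /\
    (forall eps : R, 0 < eps ->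
       \forall r \near approach a b r0,
         forall theta, coordinates N theta -> `|e (r, theta)| < eps).

(* Main.v *)
Require Import Defs.
From mathcomp Require Import all_boot all_order all_algebra.
From mathcomp Require Import all_classical all_reals all_analysis.
From mathcomp Require Import measurable_realfun.
From mathcomp Require Import ring lra.

Set Implicit Arguments.
Unset Strict Implicit.
Unset Printing Implicit Defensive.

Import Order.TTheory GRing.Theory Num.Theory.
Import numFieldNormedType.Exports.

Local Open Scope classical_set_scope.
Local Open Scope ring_scope.

(** Write u = ln (h / h0) and primes for d_r, so that m = - h0^2 u'.  Expanding
    h = h0 e^u in K = - h'' / h gives K - K0 = - (u'' + 2 (h0' / h0) u' + u'^2),
    and therefore the Riccati-type identity [m_fun_is_derive]

      d_r m = (K - K0) h0^2 + (m / h0)^2.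

    Integrate it over a compact box [s, t] x N.  By Fubini and the fundamental
    theorem of calculus in r, the left side contributes M(t) - M(s)
    ([integral_d_r_box]).  Now let s tend to a and t to b along monotone
    sequences.  The boundary terms converge by hypothesis, the curvature term by
    dominated convergence since it is integrable, and the square, being
    nonnegative, by monotone convergence.  The outcome is the exact formula
    ([integral_riccati])

      M(b) - M(a) = total + integral of (m / h0)^2,

    which contains both the integrability of (m / h0)^2 and the inequality.

    Equality means that the integral of (m / h0)^2 vanishes.  A nonnegative
    continuous function with zero integral vanishes everywhere on M
    ([integral_eq0_vanish]), so m = 0, and then the Riccati identity forces
    K = K0.  When m = 0 the quotient h / h0 has zero r-derivative, hence depends
    on theta only; if moreover it tends to 1 at some r0, it is equal to 1. *)

(** The Borel plane with the sigma-algebra on which the area measure lives. *)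
Local Notation plane R := (measurableTypeR R * measurableTypeR R)%type.

(** * Continuous functions on subsets of the plane *)

(** The boxes with rational corners are a countable basis of the plane, and they
    are measurable rectangles. *)
Lemma plane_open_measurable (R : realType) (U : set (R * R)) :
  open U -> measurable (U : set (plane R)).
Proof.
move=> oU.
pose box (q : (rat * rat) * (rat * rat)) : set (R * R) :=
  `]ratr q.1.1, ratr q.1.2[%classic `*` `]ratr q.2.1, ratr q.2.2[%classic.
have -> : U = \bigcup_q (if `[< box q `<=` U >] then box q else set0).
  apply/seteqP; split => [[x y] Uxy|p [q _]]; last first.
    by case: asboolP => // qU; exact: qU.
  have /nbhs_ballP[e /= e0 eU] : nbhs (x, y) U by exact: open_nbhs_nbhs.
  have rat_near (z : R) : exists q : rat * rat,
      [/\ z - e < ratr q.1, ratr q.1 < z, z < ratr q.2 & ratr q.2 < z + e].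
    have [q1 /itvP q1z] : exists q : rat, ratr q \in `]z - e, z[.
      by apply: rat_in_itvoo; rewrite ltrBlDr ltrDl.
    have [q2 /itvP q2z] : exists q : rat, ratr q \in `]z, z + e[.
      by apply: rat_in_itvoo; rewrite ltrDl.
    by exists (q1, q2); rewrite /= !(q1z, q2z).
  have [[qx qx'] /= [x1 x2 x3 x4]] := rat_near x.
  have [[qy qy'] /= [y1 y2 y3 y4]] := rat_near y.
  exists ((qx, qx'), (qy, qy')) => //=; case: asboolP => /= [_|].
    by split; rewrite /= in_itv/= ?x2 ?x3 ?y2 ?y3.
  case=> -[x' y'] [] /=; rewrite !in_itv/=.
  move=> /andP[x'1 x'2] /andP[y'1 y'2].
  apply: eU; split; rewrite /ball/= ltr_norml; apply/andP; split; lra.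
apply: countable_bigcupT_measurable => // q.
case: ifPn => // _; apply: measurableX; exact: measurable_itv.
Qed.

Lemma within_continuous_measurable (R : realType) (D : set (R * R))
    (f : R * R -> R) :
  measurable (D : set (plane R)) ->
  {within D, continuous f} ->
  measurable_fun (D : set (plane R)) f.
Proof.
move=> mD /continuousP cf; apply: (measurability _ (RGenOpens.measurableE R)).
move=> _ [_ [x [y ->] <-]].
have oxy : open (`]x, y[%classic : set R) by exact: interval_open.
have /open_subspaceP[V oV VD] := cf _ oxy.
rewrite setIC -VD.
by apply: measurableI => //; exact: plane_open_measurable.
Qed.

Lemma within_continuous_bounded (R : realType) (K : set (R * R))
    (f : R * R -> R) :
  compact K -> {within K, continuous f} -> [bounded f x | x in K].
Proof.
move=> cK cf; have [M [Mr hM]] := compact_bounded (continuous_compact cf cK).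
by exists M; split => // y yM x Kx; apply: (hM y yM); exists x.
Qed.

Lemma within_continuous_slice1 (R : realType) (I J : set R) (f : R * R -> R) y :
  J y -> {within I `*` J, continuous f} ->
  {within I, continuous (fun x => f (x, y))}.
Proof.
move=> Jy /subspace_continuousP cf; apply/subspace_continuousP => x Ix.
have h : (fun x => (x, y)) @ within I (nbhs x) -->
    within (I `*` J) (nbhs (x, y)).
  move=> A wA.
  have : (fun x => (x, y)) @ x --> (x, y).
    exact: (@cvg_pair _ _ _ (nbhs x) (nbhs x) (nbhs y) _ _ _
      id (cst y) cvg_id (cvg_cst y)).
  move=> /(_ _ wA) hA; change (\forall z \near x, I z -> A (z, y)).
  have {}hA : \forall z \near x, (I `*` J) (z, y) -> A (z, y) by exact: hA.
  by near=> z => Iz; apply: (near hA z).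
exact: (cvg_comp _ _ h (cf (x, y) (conj Ix Jy))).
Unshelve. all: by end_near. Qed.

Lemma within_continuous_slice2 (R : realType) (I J : set R) (f : R * R -> R) x :
  I x -> {within I `*` J, continuous f} ->
  {within J, continuous (fun y => f (x, y))}.
Proof.
move=> Ix /subspace_continuousP cf; apply/subspace_continuousP => y Jy.
have h : (fun y => (x, y)) @ within J (nbhs y) -->
    within (I `*` J) (nbhs (x, y)).
  move=> A wA.
  have : (fun y => (x, y)) @ y --> (x, y).
    exact: (@cvg_pair _ _ _ (nbhs y) (nbhs x) (nbhs y) _ _ _
      (cst x) id (cvg_cst x) cvg_id).
  move=> /(_ _ wA) hA; change (\forall z \near y, J z -> A (x, z)).
  have {}hA : \forall z \near y, (I `*` J) (x, z) -> A (x, z) by exact: hA.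
  by near=> z => Iz; apply: (near hA z).
exact: (cvg_comp _ _ h (cf (x, y) (conj Ix Jy))).
Unshelve. all: by end_near. Qed.

Lemma within_continuousM (R : realType) (S : set (R * R)) (f g : R * R -> R) :
  {within S, continuous f} -> {within S, continuous g} ->
  {within S, continuous (fun p => f p * g p)}.
Proof. by move=> cf cg x; apply: cvgM; [exact: cf|exact: cg]. Qed.

Lemma within_continuousN (R : realType) (S : set (R * R)) (f : R * R -> R) :
  {within S, continuous f} -> {within S, continuous (fun p => - f p)}.
Proof. by move=> cf x; apply: cvgN; exact: cf. Qed.

Lemma within_continuous_div (R : realType) (S : set (R * R))
    (f g : R * R -> R) :
  (forall p, S p -> g p != 0) ->
  {within S, continuous f} -> {within S, continuous g} ->
  {within S, continuous (fun p => f p / g p)}.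
Proof.
move=> g0 cf cg; apply: within_continuousM => //.
move: cg => /subspace_continuousP cg; apply/subspace_continuousP => p Sp.
by apply: cvgV; [exact: g0|exact: cg].
Qed.

(** * Radial derivatives of smooth functions *)

(** Regularity up to the boundary of S, through local extensions: in this form it
    passes from a function to its r-derivative. *)
Definition locally_C (R : realType) (S : set (R * R)) n (f : R * R -> R) :=
  forall p, S p -> exists (U : set (R * R)) (F : R * R -> R),
    [/\ open U, U p, C_order n U F & forall q, U q -> S q -> F q = f q].

(** The condition on S under which d_r at a point of S is determined by the values
    on S. *)
Definition r_open (R : realType) (S : set (R * R)) :=
  forall p, S p -> \forall r \near p.1, S (r, p.2).

Lemma d_r_eq (R : realType) (S : set (R * R)) (f g : R * R -> R) :
  r_open S -> (forall p, S p -> f p = g p) -> forall p, S p -> d_r f p = d_r g p.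
Proof.
move=> rS fg p Sp; rewrite /d_r !derive1E; apply: near_eq_derive.
by apply: filterS (rS p Sp) => r /fg.
Qed.

Lemma locally_C_continuous (R : realType) (S : set (R * R)) n f :
  locally_C S n f -> {within S, continuous f}.
Proof.
move=> Cf; apply/subspace_continuousP => p Sp.
have [U [F [oU Up CF FE]]] := Cf p Sp.
have cF : F @ within S (nbhs p) --> F p.
  apply: (@cvg_within_filter _ _ F) => //.
  by case: n CF {Cf} => [|n] [cF _]; exact: cF.
change (f @ within S (nbhs p) --> f p).
rewrite -(FE p Up Sp); apply: cvg_trans cF.
apply: near_eq_cvg; rewrite /prop_near1 /within /=.
have : nbhs p U by exact: open_nbhs_nbhs.
by apply: filterS => q Uq Sq; rewrite FE.
Qed.

Lemma locally_C_near (R : realType) (S U : set (R * R)) (f F : R * R -> R) q :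
  r_open S -> open U -> U q -> S q -> (forall q, U q -> S q -> F q = f q) ->
  \forall r \near q.1, F (r, q.2) = f (r, q.2).
Proof.
move=> rS oU Uq Sq FE.
have nU : \forall r \near q.1, U (r, q.2).
  have h : (fun r => (r, q.2)) @ q.1 --> (q.1, q.2).
    exact: (@cvg_pair _ _ _ (nbhs q.1) (nbhs q.1) (nbhs q.2) _ _ _
      id (cst q.2) cvg_id (cvg_cst q.2)).
  by apply: h; rewrite -surjective_pairing; exact: open_nbhs_nbhs.
by near=> r; apply: FE; near: r => //; exact: rS.
Unshelve. all: by end_near. Qed.

Lemma locally_C_derivable (R : realType) (S : set (R * R)) n f p :
  r_open S -> locally_C S n.+1 f -> S p ->
  derivable (fun r => f (r, p.2)) p.1 1.
Proof.
move=> rS Cf Sp; have [U [F [oU Up [_ [dF _ _ _]] FE]]] := Cf p Sp.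
by apply: near_eq_derivable (dF p Up); exact: (locally_C_near rS oU Up Sp FE).
Qed.

Lemma locally_C_is_derive (R : realType) (S : set (R * R)) n f p :
  r_open S -> locally_C S n.+1 f -> S p ->
  is_derive p.1 1 (fun r => f (r, p.2)) (d_r f p).
Proof.
move=> rS Cf Sp; rewrite /d_r derive1E; apply: derivableP.
exact: (locally_C_derivable rS Cf Sp).
Qed.

(** The r-derivative of a local extension extends the r-derivative, because
    moving slightly in the r-direction does not leave S. *)
Lemma locally_C_d_r (R : realType) (S : set (R * R)) n f :
  r_open S -> locally_C S n.+1 f -> locally_C S n (d_r f).
Proof.
move=> rS Cf p Sp; have [U [F [oU Up [_ [_ _ CF _]] FE]]] := Cf p Sp.
exists U, (d_r F); split => // q Uq Sq.
rewrite /d_r !derive1E; apply: near_eq_derive.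
exact: (locally_C_near rS oU Uq Sq FE).
Qed.

(** * Integration of radial derivatives over boxes *)

Lemma area_setX (R : realType) (A B : set (measurableTypeR R)) :
  measurable A -> measurable B ->
  (area R (A `*` B) = lebesgue_measure A * lebesgue_measure B)%E.
Proof. exact: product_measure1E. Qed.

(** J is only a measurable part of the segment so that the half-open fundamental
    domain of the circle is covered; boundedness comes from the closed box. *)
Lemma box_integrable (R : realType) (a' b' c d : R) (J : set R)
    (f : R * R -> R) :
  measurable J -> J `<=` `[c, d] ->
  {within `[a', b'] `*` `[c, d], continuous f} ->
  (area R).-integrable (`[a', b'] `*` J) (EFin \o f).
Proof.
move=> mJ Jcd cf.
have sub : `[a', b'] `*` J `<=` `[a', b'] `*` `[c, d] by move=> p [? /Jcd].
have mB : measurable (`[a', b'] `*` J).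
  by apply: measurableX => //; exact: measurable_itv.
apply: measurable_bounded_integrable => //.
- change (area R (`[a', b'] `*` J) < +oo)%E.
  rewrite area_setX; [|exact: measurable_itv|exact: mJ].
  apply: lte_mul_pinfty => //.
    by rewrite lebesgue_measure_itv/=; case: ifP.
  apply: (@le_lt_trans _ _
    (lebesgue_measure (`[c, d]%classic : set (measurableTypeR R)))).
    by apply: le_measure; rewrite ?inE//; exact: measurable_itv.
  by rewrite lebesgue_measure_itv/=; case: ifP => _; rewrite ?ltry.
- apply: within_continuous_measurable => //.
  exact: (continuous_subspaceW sub cf).
- have cK := compact_setX (@segment_compact _ a' b') (@segment_compact _ c d).
  have [M [Mr hM]] := within_continuous_bounded cK cf.
  by exists M; split => // y yM p /sub; exact: hM.
Qed.

(** Fubini, followed by the fundamental theorem of calculus on each slice of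
    constant theta. *)
Lemma integral_d_r_box (R : realType) (a' b' c d : R) (J : set R)
    (F G : R * R -> R) :
  a' < b' -> measurable J -> J `<=` `[c, d] ->
  {within `[a', b'] `*` `[c, d], continuous F} ->
  {within `[a', b'] `*` `[c, d], continuous G} ->
  (forall r theta, r \in `]a', b'[ -> J theta ->
    is_derive r 1 (fun r => F (r, theta)) (G (r, theta))) ->
  (\int[area R]_(p in `[a', b'] `*` J) (G p)%:E =
   (Rintegral lebesgue_measure J (fun theta => F (b', theta)) -
    Rintegral lebesgue_measure J (fun theta => F (a', theta)))%:E)%E.
Proof.
move=> ab mJ Jcd cF cG dF.
have mB : measurable (`[a', b'] `*` J).
  by apply: measurableX => //; exact: measurable_itv.
have iG := box_integrable mJ Jcd cG.
have iF r : r \in `[a', b'] ->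
    lebesgue_measure.-integrable J (fun theta => (F (r, theta))%:E).
  move=> Ir; apply: (@integrableS _ _ _ lebesgue_measure `[c, d]%classic J
    (EFin \o (fun theta => F (r, theta)))).
  - exact: measurable_itv.
  - exact: mJ.
  - exact: Jcd.
  apply: continuous_compact_integrable; first exact: segment_compact.
  exact: within_continuous_slice2 cF.
have -> : (\int[area R]_(p in `[a', b'] `*` J) (G p)%:E =
    \int[lebesgue_measure]_(y in J)
      \int[lebesgue_measure]_(x in `[a', b']) (G (x, y))%:E)%E.
  rewrite integral_mkcond /area -integral21_prod_meas1; last first.
    by apply/(integrable_mkcond _ _).1.
  rewrite [RHS]integral_mkcond; apply: eq_integral => y _.
  rewrite /fubini_G [RHS]patchE; case: ifPn => yJ.
    rewrite [RHS]integral_mkcond; apply: eq_integral => x _.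
    by rewrite !patchE in_setX/= yJ andbT.
  by apply: integral0_eq => x _; rewrite patchE in_setX/= (negbTE yJ) andbF.
have iFb : lebesgue_measure.-integrable J (fun theta => (F (b', theta))%:E).
  by apply: iF; rewrite in_itv/= lexx ltW.
have iFa : lebesgue_measure.-integrable J (fun theta => (F (a', theta))%:E).
  by apply: iF; rewrite in_itv/= lexx ltW.
rewrite -RintegralB; [|exact: mJ|exact: iFb|exact: iFa].
rewrite /Rintegral fineK; last first.
  exact: (integrable_fin_num _ (integrableB _ iFb iFa)).
apply: eq_integral => y /[!inE] yJ.
have cFy : {within `[a', b'], continuous (fun x => F (x, y))}.
  by apply: within_continuous_slice1 cF; exact: Jcd.
rewrite (@continuous_FTC2 _ (fun x => G (x, y)) (fun x => F (x, y)))//.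
- by apply: within_continuous_slice1 cG; exact: Jcd.
- have [_ cL cR] := (continuous_within_itvP _ ab).1 cFy.
  by split => // x xab; have := dF x y xab yJ => dFx; exact: ex_derive.
- move=> x xab; have := dF x y xab yJ => dFx.
  by rewrite derive1E; exact: derive_val.
Qed.

(** * Exhaustion of the interval (a, b) *)

Lemma ereal_approx_below (R : realType) (b : \bar R) (c : R) : (c%:E < b)%E ->
  exists s : nat -> R, [/\ nondecreasing_seq s, forall n, c < s n,
    forall n, ((s n)%:E < b)%E & (s n)%:E @[n --> \oo] --> b].
Proof.
case: b => [r| |]//; rewrite ?lte_fin => cr.
- have rc0 : 0 < r - c by rewrite subr_gt0.
  (* The denominators start at 2 so that the first term already exceeds c. *)
  exists (fun n => r - (r - c) * (n.+2%:R)^-1); split => [|n|n|].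
  + move=> m n mn; rewrite lerD2l lerN2 ler_pM2l// lef_pV2 ?posrE//.
    by rewrite ler_nat.
  + have : (n.+2%:R)^-1 < 1 :> R by rewrite invf_lt1// ltr1n.
    set x := _^-1; rewrite -subr_gt0 => /(mulr_gt0 rc0).
    by rewrite mulrBr mulr1; lra.
  + by rewrite lte_fin ltrBlDr ltrDl mulr_gt0// invr_gt0.
  + apply: cvg_EFin; first by apply: nearW.
    rewrite -[X in _ --> X]subr0; apply: cvgB; first exact: cvg_cst.
    rewrite -(mulr0 (r - c)); apply: cvgMr.
    have := @cvg_harmonic R; rewrite -(cvg_shiftS _) => h.
    exact: h.
- exists (fun n => c + n.+1%:R); split => [m n mn|n|n|].
  + by rewrite lerD2l ler_nat.
  + by rewrite ltrDl.
  + by rewrite ltry.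
  + apply/cvgeyPge => A; near=> n; rewrite lee_fin.
    have : A - c <= n%:R by near: n; exact: nbhs_infty_ger.
    by rewrite -natr1 => h; lra.
Unshelve. all: by end_near. Qed.

Lemma interval_exhaustion (R : realType) (a b : \bar R) : (a < b)%E ->
  exists s t : nat -> R,
    [/\ nonincreasing_seq s, nondecreasing_seq t,
        forall n, [/\ (a < (s n)%:E)%E, s n < t n & ((t n)%:E < b)%E],
        (s n)%:E @[n --> \oo] --> a & (t n)%:E @[n --> \oo] --> b].
Proof.
move=> ab.
have [c ac cb] : exists2 c : R, (a < c%:E)%E & (c%:E < b)%E.
  case: a b ab => [a| |] [b| |]//; rewrite ?lte_fin => ab.
  - by exists ((a + b) / 2); rewrite lte_fin ?midf_lt.
  - by exists (a + 1); rewrite ?ltry// lte_fin ltrDl.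
  - by exists (b - 1); rewrite ?ltNyr// lte_fin ltrBlDr ltrDl.
  - by exists 0; rewrite ?ltry ?ltNyr.
have [t [ndt ct tb cvt]] := ereal_approx_below cb.
have Nac : ((- c)%:E < - a)%E by rewrite EFinN lteN2.
have [s [nds cs sa cvs]] := ereal_approx_below Nac.
exists (fun n => - s n), t; split => //.
- by move=> m n mn; rewrite lerN2; exact: nds.
- move=> n; split => //; first by rewrite EFinN lteNr.
  by apply: lt_trans (ct n); rewrite ltrNl.
- by rewrite -(oppeK a); under eq_fun do rewrite EFinN; exact: cvgeN.
Qed.

(** Turns a limit along the filter of r tending to r0 into the limit of a sequence,
    as the convergence theorems for integrals require. *)
Lemma approach_seq (R : realType) (a b r0 : \bar R) (s : nat -> R) :
  (forall n, open_interval a b (s n)) -> (s n)%:E @[n --> \oo] --> r0 ->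
  s n @[n --> \oo] --> approach a b r0.
Proof.
move=> Is cs A [B nB BA].
have hB : \forall n \near \oo, B (s n)%:E by exact: cs.
have : \forall n \near \oo, A (s n).
  by near=> n; apply: BA => //; apply: (near hB n).
by [].
Unshelve. all: by end_near. Qed.

(** The filter is proper at every r0 in [a, b], the ends being reached by the
    exhausting sequences. *)
Lemma approach_exists (R : realType) (a b r0 : \bar R) (P : R -> Prop) :
  (a < b)%E -> (a <= r0)%E -> (r0 <= b)%E ->
  (\forall r \near approach a b r0, P r) ->
  exists2 r, open_interval a b r & P r.
Proof.
move=> ab ar rb.
have seq_exists (s : nat -> R) : (forall n, open_interval a b (s n)) ->
    (s n)%:E @[n --> \oo] --> r0 -> (\forall r \near approach a b r0, P r) ->
    exists2 r, open_interval a b r & P r.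
  move=> Is scv nP.
  have [n _ hn] : \forall n \near \oo, P (s n).
    exact: (approach_seq Is scv nP).
  by exists (s n) => //; apply: hn => /=.
have [s [t [_ _ stP scv tcv]]] := interval_exhaustion ab.
move: ar; rewrite le_eqVlt => /predU1P[ar|ar].
  apply: (seq_exists s); last by rewrite -ar.
  move=> n; have [sa st tb] := stP n; apply/andP; split => //.
  by rewrite (lt_trans _ tb)// lte_fin.
move: rb; rewrite le_eqVlt => /predU1P[rb|rb].
  apply: (seq_exists t); last by rewrite rb.
  move=> n; have [sa st tb] := stP n; apply/andP; split => //.
  by rewrite (lt_trans sa)// lte_fin.
case: r0 ar rb {seq_exists} => [r| |] ar rb.
- move=> [B nB BP]; have Ir : open_interval a b r by apply/andP.
  by exists r => //; apply: BP => //; exact: (nbhs_singleton nB).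
- by move: rb; rewrite ltNge leey.
- by move: ar; rewrite ltNge leNye.
Qed.

Lemma is_derive0_interval_cst (R : realType) (a b : \bar R) (f : R -> R) :
  (forall r, open_interval a b r -> is_derive r 1 f 0) ->
  forall r r', open_interval a b r -> open_interval a b r' -> f r = f r'.
Proof.
move=> df.
suff lt_cst r r' : open_interval a b r -> open_interval a b r' -> r < r' ->
    f r = f r'.
  move=> r r' Ir Ir'; have [rr'|rr'|->//] := ltgtP r r'; first exact: lt_cst.
  by apply/esym; exact: lt_cst.
move=> /andP[ar rb] /andP[ar' rb'] rr'.
have I x : x \in `[r, r'] -> open_interval a b x.
  rewrite in_itv/= => /andP[rx xr']; apply/andP; split.
    by rewrite (lt_le_trans ar)// lee_fin.
  by rewrite (le_lt_trans _ rb')// lee_fin.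
have [c _] : exists2 c, c \in `]r, r'[ & f r' - f r = 0 * (r' - r).
  apply: (@MVT _ f (fun=> 0)) => //.
    by move=> x xr; apply: df; apply: I; exact: subset_itv_oo_cc.
  apply: derivable_within_continuous => x xr.
  by have := df x (I x xr) => dfx; exact: ex_derive.
by rewrite mul0r => /subr0_eq.
Qed.

(** * The surface and its coordinates *)

Definition fiber_left (R : realType) (N : fiber R) : R :=
  if N is Segment c _ _ then c else 0.

Definition fiber_right (R : realType) (N : fiber R) : R :=
  if N is Segment _ d _ then d else 2 * pi.

Lemma fiber_left_lt_right (R : realType) (N : fiber R) :
  fiber_left N < fiber_right N.
Proof. by case: N => //=; rewrite mulr_gt0// pi_gt0. Qed.

Lemma measurable_fundamental_domain (R : realType) (N : fiber R) :
  measurable (fundamental_domain N).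
Proof. by case: N => *; exact: measurable_itv. Qed.

Lemma fundamental_domain_segment (R : realType) (N : fiber R) :
  fundamental_domain N `<=` `[fiber_left N, fiber_right N].
Proof.
case: N => [c d cd|] x /=; rewrite !in_itv/=; first by [].
by move=> /andP[-> /ltW].
Qed.

Lemma segment_coordinates (R : realType) (N : fiber R) :
  `[fiber_left N, fiber_right N] `<=` coordinates N.
Proof. by case: N => [c d cd|] x. Qed.

Lemma fundamental_domain_coordinates (R : realType) (N : fiber R) :
  fundamental_domain N `<=` coordinates N.
Proof. by case: N => [c d cd|] x. Qed.

Lemma fiber_interior (R : realType) (N : fiber R) :
  `]fiber_left N, fiber_right N[ `<=` fundamental_domain N.
Proof.
by case: N => [c d cd|] x/=; rewrite !in_itv/= => /andP[/ltW -> // /ltW].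
Qed.

Lemma near_open_interval (R : realType) (a b : \bar R) r :
  open_interval a b r -> \forall x \near r, open_interval a b x.
Proof.
by move=> /andP[ar rb]; apply: (nbhs_interval ar rb) => y ay yb; apply/andP.
Qed.

Lemma surface_r_open (R : realType) (a b : \bar R) (N : fiber R) :
  r_open (surface a b N).
Proof.
move=> [r theta] [/= Ir Nt]; apply: filterS (near_open_interval Ir) => x Ix.
by split.
Qed.

Lemma measurable_surface_domain (R : realType) (a b : \bar R) (N : fiber R) :
  measurable (surface_domain a b N : set (plane R)).
Proof.
apply: measurableX; last exact: measurable_fundamental_domain.
by apply: open_measurable; rewrite openE => r /near_open_interval.
Qed.

Lemma surface_domain_surface (R : realType) (a b : \bar R) (N : fiber R) :
  surface_domain a b N `<=` surface a b N.
Proof. by move=> p [? /fundamental_domain_coordinates]. Qed.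

Lemma smooth_locally_C (R : realType) (a b : \bar R) (N : fiber R) h n :
  smooth a b N h -> locally_C (surface a b N) n h.
Proof.
by move=> [_ sh] p Sp; have [U [F [oU Up CF FE]]] := sh p Sp; exists U, F.
Qed.

Lemma well_defined_translate (R : realType) (a b : \bar R) (f : R * R -> R)
    (r theta : R) (k : int) :
  open_interval a b r -> well_defined a b Circle f ->
  f (r, theta + 2 * pi * k%:~R) = f (r, theta).
Proof.
move=> Ir wf.
have nat_case (n : nat) t : f (r, t + 2 * pi * n%:R) = f (r, t).
  elim: n t => [|n IH] t; first by rewrite mulr0 addr0.
  rewrite -[RHS]IH -[n.+1%:R]natr1 mulrDr mulr1 addrA.
  exact: (wf (r, t + 2 * pi * n%:R)).
case: k => n; first by rewrite -pmulrn nat_case.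
rewrite NegzE -(nat_case n.+1 (theta + _)); congr (f (_, _)).
by rewrite mulrNz -pmulrn mulrN subrK.
Qed.

(** Reduction modulo 2 pi: a value taken at an arbitrary angle is already taken
    within one period. *)
Lemma well_defined_segment (R : realType) (a b : \bar R) (N : fiber R)
    (f : R * R -> R) r theta :
  well_defined a b N f -> surface a b N (r, theta) ->
  exists2 theta', theta' \in `[fiber_left N, fiber_right N] &
    f (r, theta') = f (r, theta).
Proof.
case: N => [c d cd|] wf [/= Ir Nt]; first by exists theta.
have pi2 : 0 < 2 * pi :> R by rewrite mulr_gt0// pi_gt0.
pose k := Num.floor (theta / (2 * pi)).
exists (theta + 2 * pi * (- k)%:~R); last first.
  by rewrite (well_defined_translate _ _ Ir wf).
have k1 : k%:~R <= theta / (2 * pi) by exact: floor_le.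
have k2 : theta / (2 * pi) < (k + 1)%:~R by exact: floorD1_gt.
rewrite ler_pdivlMr// in k1; rewrite ltr_pdivrMr// intrD in k2.
by rewrite in_itv/= mulrNz; apply/andP; split; lra.
Qed.

(** A positive value of g would persist on a box of positive area contained in the
    domain of integration. *)
Lemma integral_eq0_vanish (R : realType) (a b : \bar R) (N : fiber R)
    (g : R * R -> R) :
  {within surface a b N, continuous g} -> well_defined a b N g ->
  (forall p, surface a b N p -> 0 <= g p) ->
  (\int[area R]_(p in surface_domain a b N) (g p)%:E = 0)%E ->
  forall p, surface a b N p -> g p = 0.
Proof.
move=> cg wg g0 ig [r theta0] Sp.
have [theta ct <-] := well_defined_segment wg Sp.
have Ir : open_interval a b r by case: Sp.
have {Sp theta0}Sp : surface a b N (r, theta).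
  by split=> //; exact: segment_coordinates.
apply/eqP; rewrite eq_le g0// andbT leNgt; apply/negP => gp.
(* g exceeds half its value at the point on a box around it; the theta-side is
   clipped to N because the point may lie on the boundary of M. *)
pose eps := g (r, theta) / 2.
have eps0 : 0 < eps by rewrite divr_gt0.
have epsg : eps < g (r, theta) by rewrite /eps; lra.
have near_g : \forall q \near (r, theta), surface a b N q -> eps < g q.
  have := (@subspace_continuousP _ _ _ _).1 cg _ Sp.
  move=> /(_ [set y | eps < y]); apply.
  exact: lt_nbhsr epsg.
have /nbhs_ballP[e1 /= e10 e1g] := near_g.
have /nbhs_ballP[e2 /= e20 e2I] := near_open_interval Ir.
pose e := Num.min e1 e2.
have e0 : 0 < e by rewrite lt_min e10.
move: ct; rewrite in_itv/= => /andP[ct td].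
have cd := fiber_left_lt_right N.
pose t1 := Num.max (fiber_left N) (theta - e).
pose t2 := Num.min (fiber_right N) (theta + e).
have t12 : t1 < t2.
  rewrite gt_max !lt_min cd/=; apply/andP; split; last (apply/andP; split); lra.
pose A : set R := `]r, r + e[%classic; pose B : set R := `]t1, t2[%classic.
have AI : A `<=` open_interval a b.
  move=> x; rewrite /A/= in_itv/= => /andP[rx xe].
  apply: e2I; rewrite /ball/= ltr_norml.
  have : e <= e2 by rewrite ge_min lexx orbT.
  by move=> ?; apply/andP; split; lra.
have BF : B `<=` fundamental_domain N.
  move=> x; rewrite /B/= in_itv/= gt_max lt_min.
  move=> /andP[/andP[cx _] /andP[xd _]].
  by apply: fiber_interior; rewrite /= in_itv/= cx.
have gAB q : (A `*` B) q -> eps <= g q.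
  move=> [Aq Bq]; apply/ltW/e1g; last first.
    by apply: surface_domain_surface; split; [exact: AI|exact: BF].
  have ee1 : e <= e1 by rewrite ge_min lexx.
  move: Aq Bq; rewrite /A /B/= !in_itv/= gt_max lt_min.
  move=> /andP[? ?] /andP[/andP[_ ?] /andP[_ ?]].
  by split; rewrite /ball/= ltr_norml; apply/andP; split; lra.
have mA : measurable A by exact: measurable_itv.
have mB : measurable B by exact: measurable_itv.
have mAB : measurable (A `*` B : set (plane R)).
  by exact: measurableX.
have mg : measurable_fun (surface_domain a b N : set (plane R)) g.
  apply: within_continuous_measurable; first exact: measurable_surface_domain.
  exact: (continuous_subspaceW (@surface_domain_surface _ _ _ _) cg).
have ABD : A `*` B `<=` surface_domain a b N.
  by move=> q [Aq Bq]; split; [exact: AI|exact: BF].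
suff : (0 < \int[area R]_(p in surface_domain a b N) (g p)%:E)%E.
  by rewrite ig ltxx.
apply: (@lt_le_trans _ _ (\int[area R]_(p in A `*` B) (g p)%:E)%E); last first.
  apply: ge0_subset_integral => //.
  - exact: measurable_surface_domain.
  - exact/measurable_EFinP.
  - by move=> q /surface_domain_surface Sq; rewrite lee_fin g0.
apply: (@lt_le_trans _ _ (\int[area R]_(p in A `*` B) eps%:E)%E); last first.
  apply: ge0_le_integral => //.
    by move=> q _; rewrite lee_fin ltW.
  apply/measurable_EFinP; apply: (measurable_funS _ ABD mg).
  exact: measurable_surface_domain.
rewrite integral_cst//; apply: mule_gt0; first by rewrite lte_fin.
change (0 < area R (A `*` B))%E.
rewrite area_setX; [|exact: mA|exact: mB].
apply: mule_gt0; rewrite lebesgue_measure_itv/= lte_fin ?ltrDl ?e0 ?t12;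
  by rewrite -EFinB lte_fin; lra.
Qed.

(** * The Riccati identity *)

Section riccati.
Context (R : realType) (S : set (R * R)) (h h0 : R * R -> R).
Hypotheses (rS : r_open S)
  (h_gt0 : forall p, S p -> 0 < h p) (h0_gt0 : forall p, S p -> 0 < h0 p).

(** Free of logarithms, this form of m can be differentiated once more, and its
    continuity is visible. *)
Lemma m_funE n p : locally_C S n.+1 h -> locally_C S n.+1 h0 -> S p ->
  m_fun h h0 p = h0 p * d_r h0 p - h0 p ^+ 2 * (d_r h p / h p).
Proof.
move=> Ch Ch0 Sp; have hp := h_gt0 Sp; have h0p := h0_gt0 Sp.
have dh := locally_C_is_derive rS Ch Sp.
have dh0 := locally_C_is_derive rS Ch0 Sp.
have h0pE : h0 (p.1, p.2) != 0 by rewrite -surjective_pairing gt_eqF.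
have dlog : is_derive p.1 1 (fun r => ln (h (r, p.2) / h0 (r, p.2)))
    (d_r h p / h p - d_r h0 p / h0 p).
  have dq := is_deriveM dh (is_deriveV h0pE dh0).
  have q0 : 0 < h (p.1, p.2) / h0 (p.1, p.2).
    by rewrite -surjective_pairing divr_gt0.
  refine (@is_derive_eq _ _ _ _ _ _ _ _ 
    (@is_derive1_comp _ (@ln R) (fun r => h (r, p.2) / h0 (r, p.2)) _ _ _
      (is_derive1_ln q0) dq) _).
  rewrite -!surjective_pairing /GRing.scale/=; field.
  by rewrite !gt_eqF.
have dlogE : d_r (fun q => ln (h q / h0 q)) p =
    d_r h p / h p - d_r h0 p / h0 p.
  by rewrite -(@derive_val _ _ _ _ _ _ _ dlog); exact: derive1E.
rewrite /m_fun dlogE.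
by field; rewrite !gt_eqF.
Qed.

Hypotheses (Ch : locally_C S 2 h) (Ch0 : locally_C S 2 h0).

(** In terms of u = ln (h / h0) the right-hand side is
    - h0^2 u'' - 2 h0 h0' u', the derivative of - h0^2 u': the square cancels the
    u'^2 term of the curvature difference. *)
Lemma m_fun_is_derive p : S p ->
  is_derive p.1 1 (fun r => m_fun h h0 (r, p.2))
    ((curvature h p - curvature h0 p) * h0 p ^+ 2 + (m_fun h h0 p / h0 p) ^+ 2).
Proof.
move=> Sp; have hp := h_gt0 Sp; have h0p := h0_gt0 Sp.
have hpE : h (p.1, p.2) != 0 by rewrite -surjective_pairing gt_eqF.
have dh := locally_C_is_derive rS Ch Sp.
have dh0 := locally_C_is_derive rS Ch0 Sp.
have ddh := locally_C_is_derive rS (locally_C_d_r rS Ch) Sp.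
have ddh0 := locally_C_is_derive rS (locally_C_d_r rS Ch0) Sp.
have near_mE : \forall r \near p.1,
    h0 (r, p.2) * d_r h0 (r, p.2) -
      h0 (r, p.2) ^+ 2 * (d_r h (r, p.2) / h (r, p.2)) = m_fun h h0 (r, p.2).
  by apply: filterS (rS Sp) => r /(m_funE Ch Ch0) ->.
apply: near_eq_is_derive near_mE _.
have D := is_deriveB (is_deriveM dh0 ddh0)
  (is_deriveM (is_deriveX 2 dh0) (is_deriveM ddh (is_deriveV hpE dh))).
refine (@is_derive_eq _ _ _ _ _ _ _ _ D _).
rewrite (m_funE Ch Ch0)// /curvature !fctE -!surjective_pairing.
rewrite /GRing.scale/= expr1.
by field; rewrite !gt_eqF.
Qed.

Lemma curvature_continuous f : locally_C S 2 f -> (forall p, S p -> 0 < f p) ->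
  {within S, continuous (curvature f)}.
Proof.
move=> Cf f0; apply: within_continuousN; apply: within_continuous_div.
- by move=> p Sp; rewrite gt_eqF// f0.
- exact: locally_C_continuous (locally_C_d_r rS (locally_C_d_r rS Cf)).
- exact: locally_C_continuous Cf.
Qed.

Lemma m_fun_continuous : {within S, continuous (m_fun h h0)}.
Proof.
have ch := locally_C_continuous Ch; have ch0 := locally_C_continuous Ch0.
have cdh := locally_C_continuous (locally_C_d_r rS Ch).
have cdh0 := locally_C_continuous (locally_C_d_r rS Ch0).
apply: (@subspace_eq_continuous _ _ _
  (fun p => h0 p * d_r h0 p - h0 p ^+ 2 * (d_r h p / h p))).
  by move=> p /[!inE] Sp; exact/esym/(m_funE Ch Ch0).
apply: within_continuousB; first exact: within_continuousM.
apply: within_continuousM; first exact: within_continuousM.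
by apply: within_continuous_div => // p Sp; rewrite gt_eqF// h_gt0.
Qed.

End riccati.

(** The derivative of h / h0 is the multiple - h / h0^3 of m. *)
Lemma m_fun_eq0_quotient (R : realType) (S : set (R * R))
    (h h0 : R * R -> R) p :
  r_open S -> locally_C S 1 h -> locally_C S 1 h0 ->
  (forall p, S p -> 0 < h p) -> (forall p, S p -> 0 < h0 p) ->
  S p -> m_fun h h0 p = 0 ->
  is_derive p.1 1 (fun r => h (r, p.2) / h0 (r, p.2)) 0.
Proof.
move=> rS Ch Ch0 h_gt0 h0_gt0 Sp.
rewrite (m_funE rS h_gt0 h0_gt0 Ch Ch0)// => m0.
have hp := h_gt0 _ Sp; have h0p := h0_gt0 _ Sp.
have dh := locally_C_is_derive rS Ch Sp.
have dh0 := locally_C_is_derive rS Ch0 Sp.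
have h0pE : h0 (p.1, p.2) != 0 by rewrite -surjective_pairing gt_eqF.
refine (@is_derive_eq _ _ _ _ _ _ _ _ (is_deriveM dh (is_deriveV h0pE dh0)) _).
rewrite -!surjective_pairing /GRing.scale/=.
have -> : h p * (- h0 p ^- 2 * d_r h0 p) + (h0 p)^-1 * d_r h p =
    - (h p / h0 p ^+ 3) * (h0 p * d_r h0 p - h0 p ^+ 2 * (d_r h p / h p)).
  by field; rewrite !gt_eqF.
by rewrite m0 mulr0.
Qed.

Lemma m_fun_well_defined (R : realType) (a b : \bar R) (N : fiber R)
    (h h0 : R * R -> R) :
  well_defined a b N h -> well_defined a b N h0 ->
  well_defined a b N (m_fun h h0).
Proof.
case: N => //= wh wh0 p Sp; rewrite /m_fun wh0//; congr (_ * _).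
rewrite /d_r !derive1E; apply: near_eq_derive.
apply: filterS (surface_r_open Sp) => r Sr /=.
by rewrite (wh (r, p.2))// (wh0 (r, p.2)).
Qed.

(** * The integrated identity and the theorem *)

(** Over each box the integral of e is expressed by the other terms, which have
    finite limits; as e is nonnegative, monotone convergence identifies the limit
    with the integral of e over M, which is thereby finite. *)
Lemma integral_riccati (R : realType) (a b : \bar R) (N : fiber R)
    (m k e : R * R -> R) (Ma Mb : R) :
  (a < b)%E ->
  {within surface a b N, continuous m} ->
  {within surface a b N, continuous k} ->
  {within surface a b N, continuous e} ->
  (forall p, surface a b N p -> 0 <= e p) ->
  (forall p, surface a b N p ->
    is_derive p.1 1 (fun r => m (r, p.2)) (k p + e p)) ->
  (area R).-integrable (surface_domain a b N) (EFin \o k) ->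
  let M r := Rintegral lebesgue_measure (fundamental_domain N)
    (fun theta => m (r, theta)) in
  M r @[r --> approach a b a] --> Ma -> M r @[r --> approach a b b] --> Mb ->
  (\int[area R]_(p in surface_domain a b N) (e p)%:E =
   (Mb - Ma - Rintegral (area R) (surface_domain a b N) k)%:E)%E.
Proof.
move=> ab cm ck ce e0 dm ik M Mcva Mcvb.
have [s [t [sdec tinc stP scv tcv]]] := interval_exhaustion ab.
have mFD := measurable_fundamental_domain N.
have mSD := @measurable_surface_domain R a b N.
pose Q n : set (plane R) :=
  `[s n, t n]%classic `*` fundamental_domain N.
have boxS n : `[s n, t n] `*` `[fiber_left N, fiber_right N] `<=` surface a b N.
  move=> [r theta] [/=]; rewrite in_itv/=.
  move=> /andP[sr rt] /segment_coordinates Ct.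
  have [as_ _ tb] := stP n; split => //=.
  by apply/andP; split; [apply: lt_le_trans as_ _|apply: le_lt_trans tb];
    rewrite lee_fin.
have mQ n : measurable (Q n).
  by apply: measurableX => //; exact: measurable_itv.
have QSD n : Q n `<=` surface_domain a b N.
  move=> p [pr pF]; split => //.
  by have [] := boxS n p (conj pr (fundamental_domain_segment pF)).
have Qinc : nondecreasing_seq Q.
  move=> i j ij; apply/subsetPset => p [/= + pF].
  rewrite in_itv/= => /andP[sr rt]; split => //=.
  by rewrite in_itv/= (le_trans (sdec _ _ ij))//= (le_trans rt)// tinc.
(* The endpoints s n and t n leave every compact part of (a, b), so each point
   is eventually captured; this gives both the union of the boxes and the
   pointwise convergence of the truncations of k. *)
have Qev p : surface_domain a b N p -> \forall n \near \oo, Q n p.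
  move=> [/andP[ap pb] pF].
  have sp : \forall n \near \oo, ((s n)%:E < p.1%:E)%E.
    apply: (scv [set y | (y < p.1%:E)%E]); apply: open_nbhs_nbhs; split => //.
    exact: open_ereal_lt_ereal.
  have tp : \forall n \near \oo, (p.1%:E < (t n)%:E)%E.
    apply: (tcv [set y | (p.1%:E < y)%E]); apply: open_nbhs_nbhs; split => //.
    exact: open_ereal_gt_ereal.
  near=> n; split => //=; rewrite in_itv/=.
  apply/andP; split; apply: ltW; rewrite -lte_fin.
  - by apply: (near sp n).
  - by apply: (near tp n).
have Qcup : \bigcup_n Q n = surface_domain a b N.
  apply/seteqP; split => [p [n _ /QSD//]|p Sp].
  by have [n _ hn] := Qev p Sp; exists n => //; apply: hn => /=.
have QintE n : (\int[area R]_(p in Q n) (e p)%:E =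
    (M (t n) - M (s n))%:E - \int[area R]_(p in Q n) (k p)%:E)%E.
  have [_ st _] := stP n.
  have cke : {within surface a b N, continuous (fun p => k p + e p)}.
    exact: within_continuousD.
  have box_cont (f : R * R -> R) : {within surface a b N, continuous f} ->
      {within `[s n, t n] `*` `[fiber_left N, fiber_right N], continuous f}.
    by move=> cf; exact: (continuous_subspaceW (boxS n) cf).
  have box_int (f : R * R -> R) : {within surface a b N, continuous f} ->
      (area R).-integrable (Q n) (EFin \o f).
    move=> cf.
    apply: (box_integrable (c := fiber_left N) (d := fiber_right N)) => //.
      exact: fundamental_domain_segment.
    exact: box_cont.
  have dbox r theta : r \in `]s n, t n[ -> fundamental_domain N theta ->
      is_derive r 1 (fun r => m (r, theta)) (k (r, theta) + e (r, theta)).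
    move=> rst Ft; apply: (dm (r, theta)); apply: (boxS n); split.
      by move: rst; rewrite /= !in_itv/= => /andP[/ltW -> /ltW].
    exact: fundamental_domain_segment.
  have /esym -> := integral_d_r_box st mFD (@fundamental_domain_segment _ N)
    (box_cont _ cm) (box_cont _ cke) dbox.
  rewrite [X in (X - _)%E](_ : _ = \int[area R]_(p in Q n) (k p)%:E
      + \int[area R]_(p in Q n) (e p)%:E)%E; last first.
    by rewrite -integralD_EFin//; [exact: box_int|exact: box_int].
  rewrite addeAC subee ?add0e//.
  exact: (integrable_fin_num _ (box_int _ ck)).
have ke_cvg : (\int[area R]_(p in Q n) (e p)%:E @[n --> \oo] -->
    \int[area R]_(p in surface_domain a b N) (e p)%:E)%E.
  rewrite -Qcup; apply: ge0_nondecreasing_set_cvg_integral => //.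
  - move=> n; apply/measurable_EFinP; apply: within_continuous_measurable => //.
    apply: continuous_subspaceW ce.
    exact: (subset_trans (QSD n) (@surface_domain_surface _ _ _ _)).
  - by move=> n p /QSD /surface_domain_surface Sp; rewrite lee_fin e0.
have k_cvg : (\int[area R]_(p in Q n) (k p)%:E @[n --> \oo] -->
    \int[area R]_(p in surface_domain a b N) (k p)%:E)%E.
  have mk := measurable_int _ ik.
  have -> : (fun n => \int[area R]_(p in Q n) (k p)%:E)%E = (fun n =>
      \int[area R]_(p in surface_domain a b N) ((EFin \o k) \_ (Q n)) p)%E.
    by apply/funext => n; rewrite -integral_mkcondr setIidr.
  have [//|||||_ _] := @dominated_convergence _ _ R (area R) _ mSD
    (fun n => (EFin \o k) \_ (Q n)) (EFin \o k) (abse \o (EFin \o k)).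
  - move=> n; apply/(measurable_restrict _ (mQ n) mSD).
    exact: (measurable_funS mSD).
  - exact: mk.
  - apply: aeW => p Sp; apply: cvg_near_cst.
    by apply: filterS (Qev p Sp) => n Qnp; rewrite patchE mem_set.
  - exact: integrable_abse.
  - apply: aeW => p n _; rewrite patchE; case: ifPn => //= _.
    by rewrite normr0 lee_fin.
  by [].
have Icv : (\int[area R]_(p in Q n) (e p)%:E @[n --> \oo] -->
    (Mb - Ma)%:E - \int[area R]_(p in surface_domain a b N) (k p)%:E)%E.
  under eq_fun do rewrite QintE.
  have kfin := integrable_fin_num mSD ik.
  apply: cvgeB; last exact: k_cvg.
    exact: fin_num_adde_defr.
  have Mcv : M (t n) - M (s n) @[n --> \oo] --> Mb - Ma.
    apply: cvgB.
      apply: (cvg_comp _ _ (approach_seq _ tcv) Mcvb) => n.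
      have [as_ st tb] := stP n.
      by rewrite /open_interval/= tb (lt_trans as_)// lte_fin.
    apply: (cvg_comp _ _ (approach_seq _ scv) Mcva) => n.
    have [as_ st tb] := stP n.
    by rewrite /open_interval/= as_ (lt_trans _ tb)// lte_fin.
  by apply/fine_cvgP; split; [exact: nearW|exact: Mcv].
rewrite (cvg_unique _ ke_cvg Icv)//.
by rewrite /Rintegral [RHS]EFinB fineK//; exact: integrable_fin_num.
Unshelve. all: by end_near. Qed.

Theorem theorem2p2 (R : realType) (a b : \bar R) (N : fiber R)
    (h h0 : R * R -> R) (Ma Mb : R) :
  (a < b)%E ->
  smooth a b N h -> smooth a b N h0 ->
  positive a b N h -> positive a b N h0 ->
  L1 a b N (fun p => curvature h p - curvature h0 p) (fun p => h0 p ^+ 2) ->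
  M_fun N h h0 r @[r --> approach a b a] --> Ma ->
  M_fun N h h0 r @[r --> approach a b b] --> Mb ->
  let total := Rintegral (area R) (surface_domain a b N)
    (fun p => (curvature h p - curvature h0 p) * h0 p ^+ 2) in
  [/\ L1 a b N (fun p => (m_fun h h0 p / h0 p) ^+ 2) (fun=> 1),
      Mb - Ma >= total,
      Mb - Ma = total <->
        (forall p, surface a b N p -> curvature h p = curvature h0 p) /\
        (forall p, surface a b N p -> m_fun h h0 p = 0),
      (forall p, surface a b N p -> m_fun h h0 p = 0) ->
        forall r r' theta,
          surface a b N (r, theta) -> surface a b N (r', theta) ->
          h (r, theta) / h0 (r, theta) = h (r', theta) / h0 (r', theta)
    & forall r0 : \bar R, (a <= r0)%E -> (r0 <= b)%E ->
        asymptotic a b N h h0 r0 ->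
        (Mb - Ma = total <-> metric_eq a b N (metric h) (metric h0))].
Proof.
move=> ab sh sh0 h_gt0 h0_gt0 ik Mcva Mcvb total.
pose S := surface a b N.
have rS : r_open S by exact: surface_r_open.
have Ch n : locally_C S n h by exact: smooth_locally_C.
have Ch0 n : locally_C S n h0 by exact: smooth_locally_C.
have ch0 := locally_C_continuous (Ch0 0%N).
pose k p := (curvature h p - curvature h0 p) * h0 p ^+ 2.
pose e p := (m_fun h h0 p / h0 p) ^+ 2.
have cm : {within S, continuous (m_fun h h0)} by exact: m_fun_continuous.
have ck : {within S, continuous k}.
  apply: within_continuousM; last exact: within_continuousM.
  by apply: within_continuousB; apply: curvature_continuous.
have ce : {within S, continuous e}.
  have cq : {within S, continuous (fun p => m_fun h h0 p / h0 p)}.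
    by apply: within_continuous_div => // p Sp; rewrite gt_eqF// h0_gt0.
  exact: within_continuousM.
have e_ge0 p : S p -> 0 <= e p by rewrite sqr_ge0.
have dm p : S p -> is_derive p.1 1 (fun r => m_fun h h0 (r, p.2)) (k p + e p).
  exact: m_fun_is_derive.
have energy := integral_riccati ab cm ck ce e_ge0 dm ik Mcva Mcvb.
(* By energy, the defect of the inequality is the integral of e. *)
have defect_ge0 : 0 <= Mb - Ma - total.
  rewrite -lee_fin -energy; apply: integral_ge0 => p /surface_domain_surface Sp.
  by rewrite lee_fin e_ge0.
have m0_of_eq : Mb - Ma = total -> forall p, S p -> m_fun h h0 p = 0.
  move=> eq p Sp.
  have we : well_defined a b N e.
    have := m_fun_well_defined sh.1 sh0.1; move: sh0.1.
    by rewrite /e; case: (N) => //= wh0 wm q Sq; rewrite wh0// wm.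
  have : e p = 0.
    apply: (integral_eq0_vanish ce we e_ge0) Sp.
    by rewrite energy eq subrr.
  move/eqP; rewrite sqrf_eq0 mulf_eq0 invr_eq0 (gt_eqF (h0_gt0 _ Sp)) orbF.
  by move/eqP.
have K_of_m0 : (forall p, S p -> m_fun h h0 p = 0) ->
    forall p, S p -> curvature h p = curvature h0 p.
  move=> m0 p Sp; apply/eqP; rewrite -subr_eq0.
  have : k p + e p = 0.
    rewrite -(@derive_val _ _ _ _ _ _ _ (dm p Sp)).
    transitivity ('D_1 (cst (0 : R)) p.1); last exact: derive_cst.
    apply: near_eq_derive.
    by apply: filterS (rS p Sp) => r /m0.
  rewrite /k /e m0// mul0r expr0n addr0 => /eqP.
  by rewrite mulf_eq0 sqrf_eq0 (gt_eqF (h0_gt0 _ Sp)) orbF.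
have eq_of_m0 : (forall p, S p -> m_fun h h0 p = 0) -> Mb - Ma = total.
  move=> m0; apply: subr0_eq; apply: EFin_inj; rewrite -energy.
  apply: integral0_eq => p /surface_domain_surface Sp.
  by rewrite /e m0// mul0r expr0n.
have q_cst : (forall p, S p -> m_fun h h0 p = 0) -> forall r r' theta,
    S (r, theta) -> S (r', theta) ->
    h (r, theta) / h0 (r, theta) = h (r', theta) / h0 (r', theta).
  move=> m0 r r' theta [Ir Nt] [Ir' _].
  apply: (is_derive0_interval_cst (a := a) (b := b)
    (f := fun r => h (r, theta) / h0 (r, theta))) => //.
  move=> x Ix; have Sx : S (x, theta) by split.
  exact: (m_fun_eq0_quotient rS (Ch 1%N) (Ch0 1%N) h_gt0 h0_gt0 Sx (m0 _ Sx)).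
split => //.
- apply/integrableP; split.
    apply/measurable_EFinP; under eq_fun do rewrite mulr1.
    apply: within_continuous_measurable; first exact: measurable_surface_domain.
    exact: (continuous_subspaceW (@surface_domain_surface _ _ _ _) ce).
  rewrite (_ : (\int[_]_(_ in _) _)%E = (Mb - Ma - total)%:E) ?ltry// -energy.
  by apply: eq_integral => p _; rewrite mulr1 gee0_abs// lee_fin sqr_ge0.
- by rewrite -subr_ge0.
- split=> [eq|[_ m0]]; last exact: eq_of_m0.
  by have m0 := m0_of_eq eq; split => //; exact: K_of_m0.
move=> r0 ar rb [eta [hE eta_small]]; split.
- move=> /m0_of_eq m0 p Sp u v.
  suff -> : metric h p u v = metric h0 p u v by [].
  suff hh0 : h p = h0 p by rewrite /metric hh0.
  (* Being independent of r, the quotient can be evaluated arbitrarily near r0,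
     where it is arbitrarily close to 1. *)
  suff : `|h p / h0 p - 1| <= 0.
    rewrite normr_le0 subr_eq0 => /eqP q1.
    have h0p : h0 p != 0 by rewrite gt_eqF// h0_gt0.
    by rewrite -[LHS](divfK h0p) q1 mul1r.
  apply/ler_addgt0Pr => eps eps0; rewrite add0r.
  have [r Ir small] := approach_exists ab ar rb (eta_small eps eps0).
  case: p Sp => x theta Sp; have Sr : S (r, theta) by case: Sp.
  rewrite (q_cst m0 x r theta Sp Sr) hE// mulrAC divff ?gt_eqF ?h0_gt0// mul1r.
  by rewrite addrAC subrr add0r ltW// small//; case: Sp.
- move=> geq; apply: eq_of_m0.
  have hh0 p : S p -> h p = h0 p.
    (* On d/dtheta the two metrics take the values h ^+ 2 and h0 ^+ 2. *)
    move=> Sp; have := geq p Sp (0, 1) (0, 1).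
    rewrite /metric/= mulr0 !add0r !mulr1 => /eqP.
    by rewrite eqrXn2// => [/eqP//| |]; apply: ltW;
      [exact: h_gt0|exact: h0_gt0].
  move=> p Sp; rewrite (m_funE rS h_gt0 h0_gt0 (Ch 1%N) (Ch0 1%N))// hh0//.
  rewrite (d_r_eq rS hh0 Sp).
  by field; rewrite gt_eqF// h0_gt0.
Qed.
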